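(* Let $f$ be a coloring of the subspace hypergraph $\mathcal{H}_n$ into $k$ colors $1,\dots,k$, with indicator functions $F_1,\dots,F_k$ of the color classes, extended to $\mathbb{F}_2^n$ by $F_i(\overline 0)=0$ for all $i$. Let $S=(s_{i,j,\ell})$ be a $3$-dimensional matrix of order $k$. Then $f$ is a perfect coloring of $\mathcal{H}_n$ with parameter matrix $S$ if and only if for all $j,\ell\in\{1,\dots,k\}$ and all $x\in\mathbb{F}_2^n\setminus\{\overline 0\}$ $$(F_j*F_\ell)(x)=\sum_{i=1}^k 2\,s_{i,j,\ell}\,F_i(x).$$
   Context: $\overline 0$ is the zero vector of $\mathbb{F}_2^n$. The subspace hypergraph $\mathcal{H}_n$ is the $3$-uniform hypergraph with vertex set $\mathbb{F}_2^n\setminus\{\overline 0\}$ whose hyperedges are the $3$-element sets $\{x,y,z\}$ of vertices with $x+y+z=\overline 0$. Convolution: $(g*h)(x)=\sum_{y\in\mathbb{F}_2^n}g(y)h(x-y)$. A coloring of a hypergraph into $k$ colors is a surjective function $f$ from the vertex set onto a $k$-element set of colors. The color range of a hyperedge $e$ is the multiset $\{f(x):x\in e\}$. The coloring is perfect if any two vertices of the same color have the same multiset of color ranges of incident hyperedges; equivalently, for every color $i_1$ and color range $\{i_1,i_2,i_3\}$, the number $v_{i_1,\{i_1,i_2,i_3\}}$ of hyperedges with this color range incident to a vertex $x$ of color $i_1$ does not depend on the choice of $x$. The parameter matrix of a perfect coloring of a $3$-uniform hypergraph is $S=(s_{i_1,i_2,i_3})$ (indices ranging over colors) with $s_{i,j,j}=v_{i,\{i,j,j\}}$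 and $s_{i,j,\ell}=\frac12 v_{i,\{i,j,\ell\}}$ for $j\ne\ell$. *)

(* Defs.v *)
From HB Require Import structures.
From mathcomp Require Import all_boot all_order all_algebra.
From mathcomp Require Import finmap multiset.

Set Implicit Arguments.
Unset Strict Implicit.
Unset Printing Implicit Defensive.

Import GRing.Theory Num.Theory.
Local Open Scope ring_scope.

(* A hypergraph on a finite vertex type T is given by its set of hyperedges
   E : {set {set T}}; a coloring with colors 1, ..., k is a map to 'I_k. *)
Section Colorings.
Variables (T : finType) (k : nat).
Implicit Types (E : {set {set T}}) (f : T -> 'I_k).

Definition is_coloring f : Prop := forall c : 'I_k, exists x : T, f x = c.

Definition color_range f (e : {set T}) : {mset 'I_k}%mset :=
  seq_mset [seq f x | x <- enum e].

Definition incident E (x : T) : {set {set T}} := [set e in E | x \in e].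

Definition incident_ranges E f (x : T) : {mset {mset 'I_k}}%mset :=
  seq_mset [seq color_range f e | e <- enum (incident E x)].

Definition perfect_coloring E f : Prop :=
  is_coloring f /\
  forall x y : T, f x = f y -> incident_ranges E f x = incident_ranges E f y.

Definition nb_incident E f (x : T) (r : {mset 'I_k}%mset) : nat :=
  #|[set e in incident E x | color_range f e == r]|.

(* E is meant to be 3-uniform. For a perfect coloring nb_incident E f x {i, j, l} is the same number
   v_{i,{i,j,l}} for all x of color i. As f is onto, this determines s. *)
Definition has_parameter_matrix (R : numFieldType) E f
    (s : 'I_k -> 'I_k -> 'I_k -> R) : Prop :=
  forall (i j l : 'I_k) (x : T), f x = i ->
    let v := (nb_incident E f x (seq_mset [:: i; j; l]))%:R in
    s i j l = if j == l then v else 2^-1 * v.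

End Colorings.

Definition vertex (n : nat) : finType := {x : 'rV['F_2]_n | x != 0}.

Definition subspace_hypergraph (n : nat) : {set {set vertex n}} :=
  [set e : {set vertex n} | (#|e| == 3)%N && (\sum_(x in e) val x == 0)].

Definition color_indicator (R : numFieldType) (n k : nat)
    (f : vertex n -> 'I_k) (i : 'I_k) (x : 'rV['F_2]_n) : R :=
  if (insub x : option (vertex n)) is Some v then (f v == i)%:R else 0.

Definition convolution (R : numFieldType) (n : nat)
    (g h : 'rV['F_2]_n -> R) (x : 'rV['F_2]_n) : R :=
  \sum_(y : 'rV['F_2]_n) g y * h (x - y).

(* Main.v *)
Require Import Defs.
From mathcomp Require Import all_boot all_order all_algebra.
From mathcomp Require Import finmap multiset.

(** Fix a vertex x of color i.  Since -1 = 1 in 'F_2, a term of the convolution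
    of F_j and F_l at x is nonzero exactly for a pair of vertices y and x + y of
    colors j and l; as both are nonzero, y is also different from x.  Hence the
    convolution counts the set [solutions f x j l].

    On the other hand y |-> {x, y, x + y} maps the vertices other than x onto
    the hyperedges incident to x, and the fiber over {x, a, b} is {a, b}.
    Cancelling the color of x, the color range of {x, a, b} is {i, j, l} exactly
    when the colors of a and b form the multiset {j, l}; then both of a and b
    are solutions if j = l, and one of them is otherwise.  This double counting
    is [card_solutions], and the factor 1/2 for j <> l in the definition of the
    parameter matrix makes it uniform: the number of solutions is 2 s_(i,j,l) in
    both cases ([parameter_entryP]).  As exactly one F_i is nonzero at x, the
    convolution identity at x therefore says that S has the right entries at x.

    Perfection comes for free ([parameter_matrix_perfect]): a parameter matrix
    determines, in characteristic 0, the number of incident hyperedges of every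
    color range that can occur at x, from the color of x alone. *)

Set Implicit Arguments.
Unset Strict Implicit.
Unset Printing Implicit Defensive.

Import GRing.Theory Num.Theory.
Local Open Scope ring_scope.

Lemma perm_eq_pair (C : eqType) (a b j l : C) :
  perm_eq [:: a; b] [:: j; l] = (a == j) && (b == l) || (b == j) && (a == l).
Proof.
have perm1 (c d : C) : perm_eq [:: c] [:: d] = (c == d).
  by apply/idP/eqP => [/(perm_small_eq (isT : size [:: d] <= 1)%N)[] | -> //].
apply/idP/orP => [pab | []/andP[/eqP-> /eqP->] //]; last first.
  by rewrite (perm_catC [:: l] [:: j]).
have: a \in [:: j; l] by rewrite -(perm_mem pab) mem_head.
rewrite !inE => /orP[]/eqP eqa; rewrite {a}eqa in pab *.
  by left; rewrite eqxx -perm1 -(perm_cons j).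
right; rewrite eqxx andbT -perm1 -(perm_cons l).
by rewrite (perm_trans pab) // (perm_catC [:: j] [:: l]).
Qed.

(** With a and b the colors of the two other vertices of a hyperedge, the left
    side counts those of the two that contribute to the convolution.  If j = l
    the two summands agree; if not, they exclude each other. *)
Lemma orderings_of_pair (C : eqType) (a b j l : C) :
  (((a == j) && (b == l)) + ((b == j) && (a == l)) =
   (if j == l then 2 else 1) * perm_eq [:: a; b] [:: j; l])%N.
Proof.
rewrite perm_eq_pair; case: (eqVneq j l) => [-> | neq_jl].
  by case: (a == l); case: (b == l).
case: (eqVneq a j) => [-> | _] /=; last by rewrite mul1n.
by rewrite (negPf neq_jl) andbF orbF addn0 mul1n.
Qed.

Section Ranges.
Variables (T : finType) (k : nat) (f : T -> 'I_k).

Lemma incident_rangesE (E : {set {set T}}) x r :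
  incident_ranges E f x r = nb_incident E f x r.
Proof.
rewrite mset_seqE count_map /nb_incident -size_filter cardE /enum_mem.
rewrite -!enumT; congr size; rewrite -filter_predI.
by apply: eq_filter => e; rewrite !inE andbC.
Qed.

Lemma color_range_triple x y z : uniq [:: x; y; z] ->
  color_range f [set x; y; z] = seq_mset [:: f x; f y; f z].
Proof.
move=> uniq_xyz; apply/eq_seq_msetP; rewrite -/(map f [:: x; y; z]).
apply/perm_map/uniq_perm => //; first exact: enum_uniq.
by move=> t; rewrite mem_enum !inE orbA.
Qed.

(** Multisets are cancellative, so the color of x drops out. *)
Lemma color_range_triple_eq x y z j l : uniq [:: x; y; z] ->
  (color_range f [set x; y; z] == seq_mset [:: f x; j; l]) =
  perm_eq [:: f y; f z] [:: j; l].
Proof.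
move=> uniq_xyz; rewrite color_range_triple // -(perm_cons (f x)).
exact: (sameP eqP (eq_seq_msetP _ _)).
Qed.

End Ranges.

Section SubspaceHypergraph.
Variable n : nat.
Implicit Types x y z : vertex n.

Lemma F2_addvv (v : 'rV['F_2]_n) : v + v = 0.
Proof.
apply/rowP => i; rewrite !mxE.
by apply: (@addrr_pchar2 'F_2); apply: pchar_Fp.
Qed.

Lemma F2_oppv (v : 'rV['F_2]_n) : - v = v.
Proof. by apply/eqP; rewrite eq_sym -addr_eq0 F2_addvv. Qed.

Lemma F2_addv_eq0 (u v : 'rV['F_2]_n) : (u + v == 0) = (u == v).
Proof. by rewrite addr_eq0 F2_oppv. Qed.

(** The vertex completing x and y to a hyperedge; it takes the default value x
    when y = x, where x + y is not a vertex. *)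
Definition third x y : vertex n := insubd x (val x + val y).

Lemma val_third x y : y != x -> val (third x y) = val x + val y.
Proof. by move=> neq_yx; rewrite val_insubd F2_addv_eq0 eq_sym val_eqE neq_yx. Qed.

Lemma third_neql x y : y != x -> third x y != x.
Proof.
move=> neq_yx; rewrite -val_eqE val_third //.
by rewrite -[X in _ == X]addr0 (inj_eq (addrI _)) (valP y).
Qed.

Lemma third_neqr x y : y != x -> third x y != y.
Proof.
move=> neq_yx; rewrite -val_eqE val_third //.
by rewrite -[X in _ == X]add0r (inj_eq (addIr _)) (valP x).
Qed.

Lemma thirdK x y : y != x -> third x (third x y) = y.
Proof.
move=> neq_yx; apply/val_inj; rewrite val_third ?third_neql // val_third //.
by rewrite addrA F2_addvv add0r.
Qed.

Definition edge x y : {set vertex n} := [set x; y; third x y].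

Lemma edge_uniq x y : y != x -> uniq [:: x; y; third x y].
Proof.
by move=> neq_yx; rewrite /= !inE !negb_or eq_sym neq_yx eq_sym third_neql //
  eq_sym third_neqr.
Qed.

Lemma edge_incident x y : y != x -> edge x y \in incident (subspace_hypergraph n) x.
Proof.
move=> neq_yx; have uniq_xyz := edge_uniq neq_yx.
have eq_e : edge x y =i [:: x; y; third x y] by move=> t; rewrite !inE orbA.
rewrite !inE eqxx /= andbT (eq_card eq_e) (card_uniqP uniq_xyz) eqxx /=.
rewrite (eq_bigl _ _ eq_e) -big_uniq //= !big_cons big_nil addr0 val_third //.
by rewrite [val y + _]addrCA F2_addvv addr0 F2_addvv.
Qed.

(** In characteristic 2, a hyperedge through x is determined by any one of its
    other vertices. *)
Lemma incident_edgeP x (e : {set vertex n}) :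
  e \in incident (subspace_hypergraph n) x -> exists2 y, y != x & e = edge x y.
Proof.
rewrite !inE => /andP[/andP[card_e sum_e] xe].
have: #|e :\ x| == 2%N by move: card_e; rewrite (cardsD1 x) xe.
move=> /cards2P[y [z [neq_yz def_e]]]; have neq_yx : y != x.
  by have: y \in e :\ x by [rewrite def_e !inE eqxx]; rewrite !inE => /andP[].
exists y => //.
rewrite -(setD1K xe) /edge def_e setUA; congr (_ :|: [set _]).
apply/val_inj; rewrite val_third //.
move: sum_e; rewrite (big_setD1 x) //= def_e big_setU1 ?inE //= big_set1.
by rewrite addrA F2_addv_eq0 => /eqP.
Qed.

(** The fibers of [edge x] on the vertices other than x have two elements. *)
Lemma eq_edge x y z : y != x -> z != x ->
  (edge x z == edge x y) = (z \in [set y; third x y]).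
Proof.
move=> neq_yx neq_zx; apply/eqP/idP => [eq_e | ].
  have: z \in edge x y by rewrite -eq_e !inE eqxx orbT.
  by rewrite !inE (negPf neq_zx).
rewrite !inE => /orP[] /eqP-> //; rewrite /edge thirdK //.
by rewrite -!setUA [[set y] :|: _]setUC.
Qed.

Section Coloring.
Variables (k : nat) (f : vertex n -> 'I_k).

Lemma color_range_incident x e : e \in incident (subspace_hypergraph n) x ->
  exists j l, color_range f e = seq_mset [:: f x; j; l].
Proof.
move=> /incident_edgeP[y neq_yx ->]; exists (f y), (f (third x y)).
exact/color_range_triple/edge_uniq.
Qed.

(** The y for which the term F_j(y) F_l(x - y) of the convolution is nonzero:
    y = x is excluded because F_l vanishes at 0. *)
Definition solutions x j l : {set vertex n} :=
  [set y | [&& y != x, f y == j & f (third x y) == l]].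

(** The solutions are counted hyperedge by hyperedge, along the two-to-one map
    [edge x]. *)
Lemma card_solutions x j l :
  (#|solutions x j l| = (if j == l then 2 else 1) *
     nb_incident (subspace_hypergraph n) f x (seq_mset [:: f x; j; l]))%N.
Proof.
pose G y := ((f y == j) && (f (third x y) == l) : nat).
have ->: (#|solutions x j l| = \sum_(y | y != x) G y)%N.
  by rewrite /G -big_mkcondr sum1dep_card.
rewrite (partition_big (edge x) (mem (incident (subspace_hypergraph n) x)));
  last exact: edge_incident.
rewrite /nb_incident -sum1dep_card big_mkcondr big_distrr /=.
apply: eq_bigr => _ /incident_edgeP[y neq_yx ->].
have neq_zx := third_neql neq_yx.
rewrite (eq_bigl (mem [set y; third x y])) => [|z]; last first.
  have [-> | neq_zx'] /= := eqVneq z x; last exact: eq_edge.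
  by rewrite !inE !(eq_sym x) (negPf neq_yx) (negPf neq_zx).
have neq_yz : y != third x y by rewrite eq_sym third_neqr.
rewrite big_setU1 ?inE //= big_set1 /G thirdK //.
by rewrite orderings_of_pair color_range_triple_eq ?edge_uniq //; case: perm_eq.
Qed.

Variable R : numFieldType.

Lemma color_indicator_val x i : color_indicator R f i (val x) = (f x == i)%:R.
Proof. by rewrite /color_indicator valK. Qed.

Lemma color_indicator0 i : color_indicator R f i 0 = 0.
Proof. by rewrite /color_indicator insubF ?eqxx. Qed.

Lemma convolution_solutions x j l :
  convolution (color_indicator R f j) (color_indicator R f l) (val x) =
  #|solutions x j l|%:R.
Proof.
rewrite /convolution (bigD1 0) //= color_indicator0 mul0r add0r.
rewrite -sum1dep_card natr_sum [RHS]big_mkcond.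
rewrite (reindex_omap (val : vertex n -> _) insub) => [|v nz_v]; last first.
  by case: insubP => [u _ <- | ] /=; rewrite ?nz_v.
apply: eq_big => [y | y _]; first by rewrite valK eqxx (valP y).
rewrite F2_oppv color_indicator_val.
have [-> | neq_yx] /= := eqVneq y x; first by rewrite F2_addvv color_indicator0 mulr0.
rewrite -val_third // color_indicator_val.
by case: (f y == j); case: (_ == l); rewrite ?mulr0 ?mul0r ?mulr1.
Qed.

Lemma sum_color_indicator (a : 'I_k -> R) x :
  \sum_(i < k) a i * color_indicator R f i (val x) = a (f x).
Proof.
rewrite (bigD1 (f x)) //= color_indicator_val eqxx mulr1.
rewrite big1 ?addr0 // => i neq_i.
by rewrite color_indicator_val eq_sym (negPf neq_i) mulr0.
Qed.

(** Every range occurring at x or y contains their common color, so its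
    multiplicity can be read off the matrix; all other ranges have multiplicity
    0 at both.  Equality of natural numbers is recovered from equality in R,
    which has characteristic 0. *)
Lemma parameter_matrix_perfect (s : 'I_k -> 'I_k -> 'I_k -> R) : is_coloring f ->
  has_parameter_matrix (subspace_hypergraph n) f s ->
  perfect_coloring (subspace_hypergraph n) f.
Proof.
move=> f_onto s_par; split=> // x y eq_fxy; apply/msetP => r.
rewrite !incident_rangesE.
have nb_eq j l : nb_incident (subspace_hypergraph n) f x (seq_mset [:: f x; j; l]) =
                 nb_incident (subspace_hypergraph n) f y (seq_mset [:: f x; j; l]).
  apply/eqP; rewrite -(eqr_nat R); apply/eqP.
  have := s_par _ j l x erefl; rewrite (s_par _ j l y (esym eq_fxy)) /=.
  by case: (j == l) => [-> // | /mulfI->//]; rewrite invr_eq0 pnatr_eq0.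
have range_of z : f z = f x ->
    (0 < nb_incident (subspace_hypergraph n) f z r)%N ->
    exists j l, r = seq_mset [:: f x; j; l].
  move=> eq_fz; rewrite card_gt0 => /set0Pn[e]; rewrite inE => /andP[ze /eqP <-].
  by rewrite -eq_fz; apply: color_range_incident.
have [x0 | pos_x] := posnP (nb_incident (subspace_hypergraph n) f x r); last first.
  by have [j [l ->]] := range_of x erefl pos_x; apply: nb_eq.
have [y0 | pos_y] := posnP (nb_incident (subspace_hypergraph n) f y r); last first.
  by have [j [l ->]] := range_of y (esym eq_fxy) pos_y; apply: nb_eq.
by rewrite x0 y0.
Qed.

(** The solutions count each hyperedge twice if j = l and once otherwise, which
    the factor 1/2 in the definition of the parameter matrix turns into the
    uniform factor 2. *)
Lemma parameter_entryP (s : R) x j l :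
  let v := (nb_incident (subspace_hypergraph n) f x (seq_mset [:: f x; j; l]))%:R in
  s = (if j == l then v else 2^-1 * v) <-> #|solutions x j l|%:R = 2 * s.
Proof.
rewrite /= card_solutions natrM; have nz2 : (2 : R) != 0 by rewrite pnatr_eq0.
case: (j == l); first by split=> [-> // | /(mulfI nz2)->].
by rewrite mul1r; split=> [-> | ->]; rewrite ?mulVKf ?mulKf.
Qed.

End Coloring.
End SubspaceHypergraph.

Theorem lemma2 (R : numFieldType) (n k : nat) (f : vertex n -> 'I_k)
    (hf : is_coloring f) (s : 'I_k -> 'I_k -> 'I_k -> R) :
  (perfect_coloring (subspace_hypergraph n) f /\
   has_parameter_matrix (subspace_hypergraph n) f s) <->
  (forall (j l : 'I_k) (x : 'rV['F_2]_n), x != 0 ->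
     convolution (color_indicator R f j) (color_indicator R f l) x =
     \sum_(i < k) 2 * s i j l * color_indicator R f i x).
Proof.
split=> [[_ s_par] j l v nz_v | conv_s].
  rewrite -[v]/(val (Sub v nz_v : vertex n)); set x := Sub v nz_v.
  rewrite convolution_solutions sum_color_indicator.
  exact/parameter_entryP/s_par.
have s_par : has_parameter_matrix (subspace_hypergraph n) f s.
  move=> _ j l x <-; apply/parameter_entryP.
  by rewrite -convolution_solutions conv_s ?(valP x) // sum_color_indicator.
by split=> //; apply: parameter_matrix_perfect s_par.
Qed.
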